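(* For every integer $k\ge 1$, every row of the Pascal determinantal array $\mathrm{PD}_k$ is infinitely log-concave. That is, for every $i\ge 0$ and every integer $m\ge 1$, $$\mathcal{L}^{\circ m}(\mathrm{PD}_k)_{i,j}\;\ge\;0\qquad\text{for all } j\ge 0.$$
   Context: Let $P=(P_{a,b})_{a,b\ge 0}$ be the lower-triangular Pascal matrix, $P_{a,b}=\binom{a}{b}$, with $\binom{a}{b}=0$ if $b>a$ or $b<0$. For each integer $k\ge 1$ and all $i,j\ge 0$, the Pascal determinantal array of order $k$ is $\mathrm{PD}_k(i,j)=\det\bigl(\binom{i+r}{j+s}\bigr)_{0\le r,s\le k-1}$. The log-concavity operator $\mathcal{L}$ acts row-wise on an array $A=(a_{i,j})_{i,j\ge 0}$ by $\mathcal{L}(A)_{i,j}=a_{i,j}^2-a_{i,j-1}a_{i,j+1}$, where terms with negative or out-of-range indices are taken to be zero. $\mathcal{L}^{\circ m}$ denotes the $m$-fold composition of $\mathcal{L}$. Row $i$ of $A$ is infinitely log-concave if $\mathcal{L}^{\circ m}(A)_{i,j}\ge 0$ for all $j\ge 0$ and every $m\ge 1$. *)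

(* Defs.v *)
From mathcomp Require Import all_boot all_order all_algebra.

Set Implicit Arguments.
Unset Strict Implicit.
Unset Printing Implicit Defensive.

Import Order.TTheory GRing.Theory Num.Theory.

Local Open Scope ring_scope.

Definition array := nat -> nat -> int.

Definition pascal : array := fun a b => 'C(a, b)%:Z.

Definition PD (k : nat) : array :=
  fun i j => \det (\matrix_(r < k, s < k) pascal (i + r)%N (j + s)%N).

(* Entry (i, j - 1), taken to be zero when j = 0. *)
Definition left_entry (A : array) (i j : nat) : int :=
  if j is j'.+1 then A i j' else 0.

Definition logconc (A : array) : array :=
  fun i j => A i j ^+ 2 - left_entry A i j * A i j.+1.

Definition row_infinitely_log_concave (A : array) (i : nat) : Prop :=
  forall m : nat, (1 <= m)%N -> forall j : nat, 0 <= iter m logconc A i j.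

(* Main.v *)
(**
A row of PD_k is, up to a positive constant, the sequence
j |-> \prod_(r < k) 1 / ((j + r)! (i - j + r)!), because pulling factorials out
of the rows and columns turns the determinant into a Vandermonde one.  Its
generating polynomial has only negative zeros: if f does, then so does
f(D) x^N apart from zeros at 0, and reversing the coefficients of f(D) x^N amounts to dividing them
by shifted factorials.

The operator L preserves polynomials f = \prod (x - z) with only negative
zeros (Branden's theorem).  Comparing coefficients of t^n and t^(n+2) in
f(xt) t^n f(x/t) = \prod ((x^2 + z^2) t - x z (1 + t^2)) gives
L(f)(x^2) = \sum_k p^(2k)(0) / (k! (k+1)!) with
p = \prod ((x^2 + z^2) - x z X).  If Re x > 0, then every zero
x / z + z / x of p has negative real part.  The series
\sum_k u^(2k) / (k! (k+1)!) is a limit of polynomials g_N(u) with only nonzero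
purely imaginary zeros, so g_N(D) keeps the zeros of p in the same half-plane;
this bounds |(g_N(D) p)(0)| away from 0 uniformly in N, hence L(f)(x^2) <> 0.
So all zeros of L(f) are squares of purely imaginary numbers.
*)
Require Import Defs.
From mathcomp Require Import all_boot all_order all_algebra all_field.
From mathcomp Require Import ring.

Set Implicit Arguments.
Unset Strict Implicit.
Unset Printing Implicit Defensive.

Import Order.TTheory GRing.Theory Num.Theory.

Local Open Scope ring_scope.

(** * The differential operator f(D), where D is the derivative *)

Definition diffop (R : nzRingType) (f p : {poly R}) : {poly R} :=
  \sum_(i < size f) f`_i *: p^`(i).

Lemma diffop_wide (R : nzRingType) n (f p : {poly R}) : (size f <= n)%N ->
  diffop f p = \sum_(i < n) f`_i *: p^`(i).
Proof.
move=> le_fn; rewrite /diffop (big_ord_widen _ (fun i => f`_i *: p^`(i)) le_fn).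
rewrite big_mkcond; apply: eq_bigr => i _.
by case: ltnP => // /(nth_default 0)->; rewrite scale0r.
Qed.

Lemma diffop_size (R : nzRingType) (f p : {poly R}) :
  diffop f p = \sum_(i < size p) f`_i *: p^`(i).
Proof.
rewrite (diffop_wide p (leq_maxl (size f) (size p))).
rewrite (big_ord_widen _ (fun i => f`_i *: p^`(i)) (leq_maxr (size f) (size p))).
rewrite [RHS]big_mkcond; apply: eq_bigr => i _.
by case: ltnP => // /derivn_poly0->; rewrite scaler0.
Qed.

Lemma diffopC (R : nzRingType) (c : R) (p : {poly R}) : diffop c%:P p = c *: p.
Proof. by rewrite (diffop_wide _ (size_polyC_leq1 c)) big_ord1 coefC. Qed.

(** Lets f(D) act one linear factor at a time, as a succession of operators D - a. *)
Lemma diffopM_XsubC (R : comNzRingType) (a : R) (f p : {poly R}) :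
  diffop (('X - a%:P) * f) p = diffop f (p^`() - a *: p).
Proof.
have le_sz: (size (('X - a%:P) * f)%R <= (size f).+1)%N.
  by rewrite (leq_trans (size_polyMleq _ _)) // size_XsubC.
rewrite (diffop_wide _ le_sz) /diffop.
under eq_bigr do rewrite mulrBl coefB coefXM coefCM scalerBl.
under [RHS]eq_bigr do rewrite derivnB derivnZ -derivSn scalerBr scalerA [_ * a]mulrC.
rewrite !sumrB; congr (_ - _).
  by rewrite big_ord_recl eqxx scale0r add0r.
by rewrite big_ord_recr /= nth_default // mulr0 scale0r addr0.
Qed.

(** * Polynomials with zeros in a half-plane *)

Section HalfPlane.
Variable C : numClosedFieldType.
Implicit Types (f p : {poly C}) (k e : C).

(** The direction [k] rotates the half-plane; [1], ['i] and [- 'i] together cut out a ray. The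
    margin [e] serves to bound |p(0)| from below. *)
Definition halfplane_rooted k e p :=
  p != 0 /\ forall z, root p z -> 'Re (k * z) <= - e.

Lemma deriv_prod_XsubC (s : seq C) z : z \notin s ->
  (\prod_(r <- s) ('X - r%:P))^`().[z] =
  (\prod_(r <- s) ('X - r%:P)).[z] * \sum_(r <- s) (z - r)^-1.
Proof.
elim: s => [|r s IHs]; first by rewrite !big_nil derivC !hornerE.
rewrite inE negb_or => /andP[nz_zr /IHs{}IHs].
rewrite !big_cons derivM derivXsubC !hornerE /= IHs mulrDr.
rewrite mulrAC mulfV ?subr_eq0 // !mul1r.
by rewrite mulrA.
Qed.

(** [k^* / w] is the conjugate of [k * w] divided by |w|^2. *)
Lemma Re_mulV_gt0 k w : 0 < 'Re (k * w) -> 0 < 'Re (k^* / w).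
Proof.
move=> kw_gt0; have nz_w: w != 0.
  by apply: contraTneq kw_gt0 => ->; rewrite mulr0 raddf0 ltxx.
rewrite invC_norm mulrCA -rmorphM ReMl ?rpredV ?rpredX ?normr_real //.
by rewrite Re_conj mulr_gt0 // invr_gt0 exprn_gt0 ?normr_gt0.
Qed.

(* At a zero z of p' - a p outside the half-plane, a = p'(z)/p(z) is the sum of
   the 1/(z - r) over the roots r of p, all of which satisfy
   'Re (k^* / (z - r)) > 0. *)
Lemma halfplane_deriv k e a p : e \is Num.real -> a != 0 -> 'Re (k^* * a) <= 0 ->
  halfplane_rooted k e p ->
  [/\ halfplane_rooted k e (p^`() - a *: p),
      size (p^`() - a *: p) = size p &
      lead_coef (p^`() - a *: p) = - a * lead_coef p].
Proof.
move=> Re nz_a le_ka0 [nz_p kp].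
have lead_q: lead_coef (p^`() - a *: p) = - a * lead_coef p.
  rewrite -scaleNr addrC lead_coefDl ?lead_coefZ //.
  by rewrite size_scale ?oppr_eq0 // lt_size_deriv.
have size_q: size (p^`() - a *: p) = size p.
  by rewrite -scaleNr addrC size_polyDl size_scale ?oppr_eq0 // lt_size_deriv.
split=> //; split; first by rewrite -lead_coef_eq0 lead_q mulf_neq0 ?oppr_eq0 ?lead_coef_eq0.
move=> z; rewrite rootE !hornerE subr_eq0 => /eqP qz0.
rewrite real_leNgt ?rpredN ?Creal_Re //; apply/negP => kz_gt.
have [s def_p] := closed_field_poly_normal p.
have kr r : r \in s -> 0 < 'Re (k^* / (z - r)).
  move=> s_r; apply: Re_mulV_gt0; rewrite mulrBr raddfB subr_gt0.
  by apply: le_lt_trans kz_gt; apply: kp; rewrite def_p rootZ ?lead_coef_eq0 // root_prod_XsubC.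
have s'z: z \notin s by apply/negP=> /kr; rewrite subrr invr0 mulr0 raddf0 ltxx.
have nz_pz: p.[z] != 0.
  by rewrite def_p -rootE rootZ ?lead_coef_eq0 // root_prod_XsubC.
have def_a: a = \sum_(r <- s) (z - r)^-1.
  apply: (mulfI nz_pz); rewrite mulrC -qz0 [in LHS]def_p derivZ hornerZ.
  by rewrite deriv_prod_XsubC // mulrA -hornerZ -def_p.
move: nz_a le_ka0; rewrite def_a mulr_sumr raddf_sum /=.
case: s kr {def_p s'z def_a} => [|r s] kr; first by rewrite big_nil eqxx.
move=> _; apply/negP; rewrite -real_ltNge ?real0 ?rpred_sum //.
rewrite big_cons ltr_wpDr ?kr ?mem_head // big_seq sumr_ge0 // => t s_t.
by rewrite ltW ?kr // inE s_t orbT.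
Qed.

(** Each root a of [f] contributes one operator D - a, handled by [halfplane_deriv]. The factors -a
    and the leading coefficient of [f] multiply up to f(0). *)
Lemma halfplane_diffop k e f p : e \is Num.real -> f != 0 ->
    (forall a, root f a -> a != 0 /\ 'Re (k^* * a) <= 0) ->
  halfplane_rooted k e p ->
  [/\ halfplane_rooted k e (diffop f p), size (diffop f p) = size p &
      lead_coef (diffop f p) = f`_0 * lead_coef p].
Proof.
move=> Re nz_f af; have [s def_f] := closed_field_poly_normal f.
have {}af a : a \in s -> a != 0 /\ 'Re (k^* * a) <= 0.
  by move=> s_a; apply: af; rewrite def_f rootZ ?lead_coef_eq0 // root_prod_XsubC.
move: (lead_coef f) nz_f def_f => c nz_f def_f.
have {nz_f}nz_c: c != 0 by apply: contraNneq nz_f => c0; rewrite def_f c0 scale0r.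
rewrite {f}def_f; elim: s p af => [|a s IHs] p af kp.
  rewrite big_nil alg_polyC diffopC coefC lead_coefZ size_scale //; split=> //.
  by case: kp => nz_p kp; split=> [|z]; rewrite ?scaler_eq0 ?negb_or ?nz_c ?rootZ //; apply: kp.
have [nz_a le_a0] := af a (mem_head a s).
have [kq size_q lead_q] := halfplane_deriv Re nz_a le_a0 kp.
have [|kr size_r lead_r] := IHs _ _ kq; first by move=> b s_b; apply: af; rewrite inE s_b orbT.
rewrite big_cons scalerAr diffopM_XsubC; split=> //; first by rewrite size_r.
by rewrite lead_r lead_q mulrA mulrBl coefB coefXM coefCM /= sub0r mulrN mulNr [a * _]mulrC mulNr.
Qed.

(** * Polynomials with only negative zeros *)

Definition negrooted p := 0 < lead_coef p /\ forall z, root p z -> z < 0.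

Lemma negrooted_neq0 p : negrooted p -> p != 0.
Proof. by case=> lead_gt0 _; rewrite -lead_coef_eq0 gt_eqF. Qed.

Lemma negrooted_coef_ge0 p i : negrooted p -> 0 <= p`_i.
Proof.
case=> lead_gt0 p_lt0; have nz_p: lead_coef p != 0 by rewrite gt_eqF.
have [s def_p] := closed_field_poly_normal p.
have {p_lt0}: forall z, z \in s -> z < 0.
  by move=> z s_z; apply: p_lt0; rewrite def_p rootZ // root_prod_XsubC.
rewrite def_p coefZ => {def_p}s_lt0; rewrite mulr_ge0 ?(ltW lead_gt0) //.
elim: s i s_lt0 => [|z s IHs] i s_lt0; first by rewrite big_nil coef1 ler0n.
have{}IHs j: 0 <= (\prod_(z <- s) ('X - z%:P))`_j.
  by apply: IHs => t s_t; rewrite s_lt0 // inE s_t orbT.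
rewrite big_cons mulrBl coefB coefXM coefCM -mulNr.
by rewrite addr_ge0 ?mulr_ge0 ?oppr_ge0 ?(ltW (s_lt0 _ (mem_head _ _))) //; case: eqP.
Qed.

Lemma negrooted_coef0_gt0 p : negrooted p -> 0 < p`_0.
Proof.
move=> np; rewrite lt0r negrooted_coef_ge0 // andbT -horner_coef0.
by apply/negP=> /np.2; rewrite ltxx.
Qed.

(** The closed left, upper and lower half-planes meet in the nonpositive real ray. *)
Lemma halfplane_le0 (z : C) :
  (forall k, k \in [:: 1; 'i; - 'i] -> 'Re (k * z) <= 0) -> z <= 0.
Proof.
move=> kz; have Re_le: 'Re z <= 0 by rewrite -[z]mul1r kz ?inE ?eqxx.
have Im_ge: 0 <= 'Im z by rewrite -oppr_le0 -ReMil kz ?inE ?eqxx ?orbT.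
have Im_le: 'Im z <= 0 by rewrite -['Im z]opprK -ReMil -raddfN -mulNr kz ?inE ?eqxx ?orbT.
have Im0: 'Im z = 0 by apply: le_anti; rewrite Im_le // Im_ge.
by rewrite [z]Crect Im0 mulr0 addr0 Re_le.
Qed.

(** The polynomial is g with f(D) x^(n+l) = (n+l)! x^l g. The zeros of x^(n+l) lie in the
    half-planes of all three directions, and f(D) keeps them there. Finally g(0) is nonzero because
    it is the leading coefficient of [f] over l!. *)
Lemma negrooted_reverse_fact f n l : negrooted f -> size f = n.+1 ->
  negrooted (\poly_(j < n.+1) (f`_(n - j) / (j + l)`!%:R)).
Proof.
move=> nf sz_f; set g := \poly_(j < _) _.
have nz_fact m : m`!%:R != 0 :> C by rewrite pnatr_eq0 -lt0n fact_gt0.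
have fact_gt0C m : 0 < m`!%:R^-1 :> C by rewrite invr_gt0 ltr0n fact_gt0.
have f0_gt0 := negrooted_coef0_gt0 nf.
have def_g: diffop f 'X^(n + l) = (n + l)`!%:R *: ('X^l * g).
  rewrite /diffop sz_f (reindex_inj rev_ord_inj) /g poly_def mulr_sumr scaler_sumr /=.
  apply: eq_bigr => j _; rewrite subSS derivnXn.
  have def_e: (n + l - (n - j) = l + j)%N.
    by rewrite addnC -addnBA ?leq_subr // subKn // -ltnS.
  rewrite def_e.
  rewrite -scalerAr -exprD -scaler_nat !scalerA mulrCA; congr (_ * _ *: _).
  rewrite -(@ffact_fact (n + l) (n - j)) ?(leq_trans (leq_subr _ _)) ?leq_addr //.
  by rewrite def_e [(l + j)%N]addnC natrM mulfK.
split=> [|z gz0].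
  by rewrite lead_coef_poly /= ?subnn ?mulr_gt0 // gt_eqF ?mulr_gt0.
have nz_z: z != 0.
  apply: contraTneq gz0 => ->; rewrite rootE horner_coef0 coef_poly /= subn0 add0n.
  rewrite mulf_neq0 ?gt_eqF //; have [] := nf; by rewrite lead_coefE sz_f.
rewrite lt_neqAle nz_z; apply: halfplane_le0 => k k_in.
have [] := @halfplane_diffop k 0 f 'X^(n + l) (real0 _) (negrooted_neq0 nf).
- move=> a /nf.2 a_lt0; rewrite lt_eqF //; split=> //.
  have Ra: a \is Num.real by rewrite ltr0_real.
  rewrite mulrC ReMl // Re_conj mulr_le0_ge0 ?(ltW a_lt0) //.
  by move: k_in; rewrite !inE => /or3P[]/eqP->; rewrite ?raddfN /= ?Re_i ?oppr0 ?(Creal_ReP _ _) ?rpred1.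
- split=> [|w]; first by rewrite monic_neq0 ?monicXn.
  rewrite rootE !hornerE expf_eq0 => /andP[_ /eqP->].
  by rewrite mulr0 raddf0 oppr0.
move=> [_ kz] _ _; rewrite -oppr0; apply: kz.
by rewrite def_g rootZ // rootM gz0 orbT.
Qed.

(** Two uses of [negrooted_reverse_fact]: the second reversal undoes the first. In between, f(0) > 0
    keeps the size at n + 1. *)
Lemma negrooted_div_fact f n l : negrooted f -> size f = n.+1 ->
  negrooted (\poly_(j < n.+1) (f`_j / ((j + l)`! * (n - j + l)`!)%:R)).
Proof.
move=> nf sz_f; have nr := negrooted_reverse_fact l nf sz_f.
have f0_gt0 := negrooted_coef0_gt0 nf.
set g := \poly_(_ < _) _ in nr.
have sz_g: size g = n.+1.
  by rewrite size_poly_eq // subnn mulf_neq0 ?(gt_eqF f0_gt0) // invr_eq0 pnatr_eq0 -lt0n fact_gt0.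
suffices -> : \poly_(j < n.+1) (f`_j / ((j + l)`! * (n - j + l)`!)%:R) =
    \poly_(j < n.+1) (g`_(n - j) / (j + l)`!%:R) by apply: negrooted_reverse_fact.
apply/polyP=> j; rewrite /g !coef_poly !ltnS leq_subr; case: leqP => // le_jn.
by rewrite subKn // natrM invfM mulrA mulrAC.
Qed.

Lemma negrooted_scale_var f c : 0 < c -> negrooted f ->
  negrooted (\poly_(i < size f) (f`_i * c ^+ i)).
Proof.
move=> c_gt0 [lead_gt0 f_lt0]; split=> [|z].
  have sz_f: (0 < size f)%N.
    by rewrite size_poly_gt0 -lead_coef_eq0 gt_eqF.
  have h: 0 < f`_(size f).-1 * c ^+ (size f).-1 by rewrite mulr_gt0 ?exprn_gt0.
  by rewrite lead_coef_poly // gt_eqF.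
rewrite rootE horner_poly => fz0; rewrite -(pmulr_rlt0 _ c_gt0); apply: f_lt0.
rewrite rootE horner_coef; apply/eqP; rewrite -[RHS](eqP fz0); apply: eq_bigr => i _.
by rewrite exprMn mulrA.
Qed.

Lemma negrooted_binomial n : negrooted (\poly_(i < n.+1) 'C(n, i)%:R).
Proof.
have def_f: \poly_(i < n.+1) 'C(n, i)%:R = ('X + 1) ^+ n :> {poly C}.
  by rewrite addrC exprDn poly_def; apply: eq_bigr => i _; rewrite expr1n mul1r scaler_nat.
split=> [|z]; first by rewrite lead_coef_poly //= binn ?oner_eq0.
rewrite def_f rootE !hornerE expf_eq0 addr_eq0 => /andP[_ /eqP->].
by rewrite oppr_lt0.
Qed.

(** A number with negative square is nonzero and purely imaginary. *)
Lemma negrooted_comp_X2_Re f z : negrooted f -> root (f \Po 'X^2) z ->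
  z != 0 /\ 'Re z = 0.
Proof.
move=> [_ f_lt0]; rewrite root_comp !hornerE => /f_lt0 z2_lt0.
have nz_z: z != 0 by apply: contraTneq z2_lt0 => ->; rewrite expr0n ltxx.
split=> //; apply: contraTeq z2_lt0 => nz_x; apply/negP=> z2_lt0.
have: 'Im (z ^+ 2) = 0 by apply/Creal_ImP; rewrite ltr0_real.
rewrite expr2 ImM -mulr2n => /eqP; rewrite mulrn_eq0 mulf_eq0 (negPf nz_x) /= => /eqP y0.
move: z2_lt0; rewrite [z]Crect y0 mulr0 addr0 real_ltNge ?rpredX ?real0 ?Creal_Re //.
by rewrite -realEsqr Creal_Re.
Qed.

(* The Laguerre-type polynomials \sum_i 'C(N, i) / (i.+1)`! (v / N)^i tend
   coefficientwise to \sum_i v^i / (i`! * (i.+1)`!). *)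
Definition bessel_approx N : {poly C} :=
  \poly_(i < N.+1) ('C(N, i)%:R / (i.+1)`!%:R / N%:R ^+ i).

(** Apply [negrooted_reverse_fact] with shift 1 to (1 + x)^N, whose coefficients are symmetric, and
    replace x by x / N. *)
Lemma negrooted_bessel_approx N : (0 < N)%N -> negrooted (bessel_approx N).
Proof.
move=> N_gt0; pose f := \poly_(i < N.+1) 'C(N, i)%:R : {poly C}.
have sz_f: size f = N.+1 by rewrite size_poly_eq // binn oner_eq0.
have := negrooted_reverse_fact 1 (negrooted_binomial N) sz_f.
set g := \poly_(_ < _) _ => ng.
have sz_g: size g = N.+1.
  rewrite size_poly_eq // subnn /f coef_poly bin0 mul1r.
  by rewrite invr_eq0 pnatr_eq0 -lt0n fact_gt0.
have N_gt0C : 0 < N%:R^-1 :> C by rewrite invr_gt0 ltr0n.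
have := negrooted_scale_var N_gt0C ng; congr negrooted.
apply/polyP=> i; rewrite sz_g /g !coef_poly !ltnS leq_subr; case: leqP => // le_iN.
by rewrite bin_sub // addn1 exprVn.
Qed.

(** |p(0)| is the modulus of the leading coefficient times the product of the |r| over the roots r,
    and |r| >= -Re r >= e. *)
Lemma halfplane_horner0_ge e p : 0 <= e -> halfplane_rooted 1 e p ->
  `|lead_coef p| * e ^+ (size p).-1 <= `|p.[0]|.
Proof.
move=> e_ge0 [nz_p p_rt]; have [s def_p] := closed_field_poly_normal p.
have{p_rt} s_rt r : r \in s -> e <= `|r|.
  move=> s_r; have: 'Re (1 * r) <= - e.
    by apply: p_rt; rewrite def_p rootZ ?lead_coef_eq0 // root_prod_XsubC.
  rewrite mul1r lerNr => /le_trans; apply; rewrite -normrN -raddfN.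
  by have [] := leif_Re_Creal (- r).
rewrite [in p.[0]]def_p hornerZ normrM ler_wpM2l // def_p size_scale ?lead_coef_eq0 //.
rewrite size_prod_XsubC horner_prod normr_prod /= {def_p}.
elim: s s_rt => [|r s IHs] s_rt; first by rewrite big_nil.
rewrite big_cons exprS !hornerE ?sub0r normrN ler_pM ?exprn_ge0 ?s_rt ?mem_head //.
by apply: IHs => t s_t; rewrite s_rt // inE s_t orbT.
Qed.

(** For fixed [i] the right-hand side is a polynomial in 1 / N, which makes the limit of large N an
    evaluation at 0. *)
Lemma bin_div_expn N i : (i <= N)%N -> (0 < N)%N ->
  'C(N, i)%:R / N%:R ^+ i = i`!%:R^-1 * \prod_(j < i) (1 - j%:R / N%:R) :> C.
Proof.
move=> le_iN N_gt0; have nz_N: N%:R != 0 :> C by rewrite pnatr_eq0 -lt0n.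
have nz_i: i`!%:R != 0 :> C by rewrite pnatr_eq0 -lt0n fact_gt0.
apply: (mulfI nz_i); rewrite mulVKf // mulrA -natrM mulnC bin_ffact ffact_prod.
rewrite natr_prod -[in X in _ / X](card_ord i) -prodr_const -prodf_div.
apply: eq_bigr => j _; rewrite natrB ?mulrBl ?divff //.
by rewrite (leq_trans (ltnW (ltn_ord j))).
Qed.
End HalfPlane.

(** * Passage to the limit in the Bessel-type series *)

Section Limit.
Variable C : archiClosedFieldType.
Implicit Types p : {poly C}.

(** Taylor coefficients of I_1(2u) / u, with I_1 the modified Bessel function. *)
Definition bessel_coef m : C :=
  if odd m then 0 else ((m./2)`! * (m./2).+1`!)%:R^-1.

(* The approximation with index N is the value at 1 / N of a fixed polynomial Q
   whose value at 0 is the sum below, so Q.[0] = 0 would force it to be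
   O(1 / N). *)
Lemma halfplane_bessel_neq0 e p : 0 < e -> halfplane_rooted 1 e p ->
  \sum_(m < size p) bessel_coef m * (p`_m *+ m`!) != 0.
Proof.
move=> e_gt0 hp; have [nz_p _] := hp; set n := size p.
(* A lower bound for |(q N)(0)| independent of N: the approximations have constant term 1, so [q N]
   has the size and leading coefficient of [p]. *)
pose d := `|lead_coef p| * e ^+ n.-1.
have d_gt0: 0 < d by rewrite mulr_gt0 ?exprn_gt0 // normr_gt0 lead_coef_eq0.
pose q N := diffop (bessel_approx C N \Po 'X^2) p.
have q_lb N : (0 < N)%N -> d <= `|(q N).[0]|.
  move=> N_gt0; have nb := negrooted_bessel_approx C N_gt0.
  have f0: (bessel_approx C N \Po 'X^2)`_0 = 1.
    by rewrite coef_comp_poly_Xn // coef_poly bin0 !divr1.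
  have nz_f: bessel_approx C N \Po 'X^2 != 0.
    by apply: contra_eq_neq f0 => ->; rewrite coef0 eq_sym oner_eq0.
  have f_rt a : root (bessel_approx C N \Po 'X^2) a -> a != 0 /\ 'Re (1^* * a) <= 0.
    by move=> /(negrooted_comp_X2_Re nb)[nz_a Re_a0]; rewrite rmorph1 mul1r Re_a0.
  have [hq size_q lead_q] := halfplane_diffop (gtr0_real e_gt0) nz_f f_rt hp.
  have := halfplane_horner0_ge (ltW e_gt0) hq.
  by rewrite lead_q size_q f0 mul1r.
(* The m-th term of (q N)(0), rewritten by [bin_div_expn], with the variable in place of 1 / N. *)
pose w (m : nat) : {poly C} := if odd m then 0 else
  ((p`_m *+ m`!) * bessel_coef m) *: \prod_(i < m./2) (1 - i%:R *: 'X).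
pose Q := \sum_(m < n) w m.
have Q_N N : (n <= N)%N -> Q.[N%:R^-1] = (q N).[0].
  move=> le_nN; have N_gt0: (0 < N)%N by rewrite (leq_trans _ le_nN) ?size_poly_gt0.
  rewrite /q diffop_size !horner_sum; apply: eq_bigr => m _.
  rewrite hornerZ horner_coef0 coef_derivn addn0 ffactnn coef_comp_poly_Xn //.
  rewrite dvdn2 divn2 /w /bessel_coef; case: (odd m); first by rewrite horner0 mul0r.
  have le_mN: (m./2 <= N)%N.
    by rewrite -divn2 (leq_trans (leq_div _ _)) // (leq_trans _ le_nN) // ltnW.
  rewrite coef_poly ltnS le_mN [_ / _ / _]mulrAC bin_div_expn // hornerZ horner_prod.
  under eq_bigr do rewrite !hornerE.
  by rewrite natrM invfM /=; ring.
have <- : Q.[0] = \sum_(m < n) bessel_coef m * (p`_m *+ m`!).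
  rewrite horner_sum; apply: eq_bigr => m _; rewrite /w /bessel_coef.
  case: (odd m); first by rewrite horner0 mul0r.
  rewrite hornerZ horner_prod big1 => [|i _]; first by rewrite mulr1 mulrC.
  by rewrite !hornerE ?mulr0 ?subr0.
apply/negP=> Q0; have [R def_Q] : exists R, Q = R * 'X.
  by move: Q0; rewrite -rootE => /factor_theorem[R ->]; exists R; rewrite subr0.
pose K := \sum_(i < size R) `|R`_i|.
have K_ge0: 0 <= K by rewrite sumr_ge0.
(* N > K / d gives K / N < d, and N >= n allows the use of [Q_N]. *)
pose N := (Num.bound (K / d) + n).+1.
have := q_lb N isT; rewrite -Q_N ?leqW ?leq_addl // def_Q hornerM hornerX normrM.
apply/negP; rewrite -real_ltNge ?(gtr0_real d_gt0) ?rpredM ?normr_real //.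
have N_gt0: 0 < N%:R :> C by rewrite ltr0n.
rewrite normfV normr_nat ltr_pdivrMr //.
have RK: `|R.[N%:R^-1]| <= K.
  rewrite horner_coef (le_trans (ler_norm_sum _ _ _)) // ler_sum // => i _.
  rewrite normrM ler_piMr // normrX exprn_ile1 // normfV normr_nat.
  by rewrite invf_le1 // ler1n.
apply: le_lt_trans RK _; rewrite mulrC -ltr_pdivrMr //.
apply: lt_le_trans (archi_boundP _) _; first by rewrite divr_ge0 // ltW.
by rewrite ler_nat leqW ?leq_addr.
Qed.
End Limit.

(** * Expansion of L(f)(x^2) in the coefficients of p *)

(** A product of linear forms in [u] and [v] is homogeneous, so setting u = 1, v = X already
    determines its coefficients. *)
Lemma prod_homogenize (R : comNzRingType) (I : Type) (s : seq I) (a b : I -> R)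
    (u v : {poly R}) :
  \prod_(i <- s) (a i *: u + b i *: v) =
  \sum_(m < (size s).+1)
    (\prod_(i <- s) ((a i)%:P + b i *: 'X))`_m *: (u ^+ (size s - m) * v ^+ m).
Proof.
have sz_le (t : seq I) : (size (\prod_(i <- t) ((a i)%:P + b i *: 'X))%R <= (size t).+1)%N.
  elim: t => [|i t IHt]; first by rewrite big_nil size_poly1.
  rewrite big_cons (leq_trans (size_polyMleq _ _)) // -subn1 leq_subLR.
  apply: (@leq_add _ _ 2) IHt; rewrite (leq_trans (size_polyD _ _)) // geq_max.
  rewrite (leq_trans (size_polyC_leq1 _)) //.
  by rewrite (leq_trans (size_scale_leq _ _)) ?size_polyX.
elim: s => [|i s IHs]; first by rewrite !big_nil big_ord1 coef1 scale1r mulr1.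
rewrite !big_cons {}IHs; have := sz_le s; set P := \prod_(_ <- _) _; set n := size s => sz_P.
under [RHS]eq_bigr do rewrite mulrDl coefD coefCM -scalerAl coefZ coefXM scalerDl.
rewrite big_split /= mulrDl; congr (_ + _).
  rewrite [RHS]big_ord_recr /= [P`_(size s).+1]nth_default // mulr0 scale0r addr0 mulr_sumr.
  apply: eq_bigr => m _; rewrite -scalerAl -scalerAr scalerA mulrA -exprS.
  by rewrite subSn // -ltnS.
rewrite [RHS]big_ord_recl /= mulr0 scale0r add0r mulr_sumr.
apply: eq_bigr => m _; rewrite -scalerAl -scalerAr scalerA mulrCA -exprS.
by rewrite subSS.
Qed.

Lemma coef_binomial_X2 (R : comNzRingType) m i :
  ((1 + 'X^2) ^+ m : {poly R})`_i = if odd i then 0 else 'C(m, i./2)%:R.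
Proof.
have -> : (1 + 'X^2) ^+ m = (1 + 'X) ^+ m \Po 'X^2 :> {poly R}.
  by rewrite rmorphXn /= rmorphD rmorph1 /= comp_polyX.
rewrite coef_comp_poly_Xn // dvdn2 divn2; case: (odd i) => //=.
rewrite exprDn coef_sum.
under eq_bigr do rewrite expr1n mul1r coefMn coefXn.
have [le_im|lt_mi] := leqP i./2 m.
  rewrite (bigD1 (inord i./2)) //= inordK // eqxx big1 ?addr0 // => j.
  by rewrite -val_eqE /= inordK // eq_sym => /negPf->; rewrite mul0rn.
rewrite bin_small // big1 // => j _; rewrite gtn_eqF ?mul0rn //.
by rewrite (leq_trans (ltn_ord j)).
Qed.

(* F = f(xt) and H = t^n f(x / t) as polynomials in t; the two sides are the
   coefficient of t^n minus that of t^(n+2) in F * H. *)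
Lemma logconc_prod_XsubC (R : comNzRingType) (s : seq R) (x : R) :
  let f := \prod_(z <- s) ('X - z%:P) in
  let p := \prod_(z <- s) ((x ^+ 2 + z ^+ 2)%:P + - (x * z) *: 'X) in
  \sum_(k < (size s).+1) (f`_k ^+ 2 - (f * 'X)`_k * f`_k.+1) * (x ^+ 2) ^+ k =
  \sum_(m < (size s).+1 | ~~ odd m) p`_m * ('C(m, m./2)%:R - 'C(m, m./2.+1)%:R).
Proof.
move=> f p; set n := size s.
pose F := \prod_(z <- s) (- z *: 1 + 1 *: (x *: 'X) : {poly R}).
pose H := \prod_(z <- s) (- z *: 'X + 1 *: x%:P : {poly R}).
have def_f : f = \prod_(z <- s) ((- z)%:P + 1 *: 'X).
  by apply: eq_bigr => z _; rewrite scale1r polyCN addrC.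
have sz_f: size f = n.+1 by rewrite size_prod_XsubC.
have F_ i : F`_i = f`_i * x ^+ i.
  have -> : F = \poly_(m < n.+1) (f`_m * x ^+ m).
    rewrite /F prod_homogenize -def_f poly_def; apply: eq_bigr => m _.
    by rewrite expr1n mul1r exprZn scalerA.
  by rewrite coef_poly -sz_f; case: ltnP => // /(nth_default 0)->; rewrite mul0r.
have H_ i : H`_i = if (i <= n)%N then f`_(n - i) * x ^+ (n - i) else 0.
  have -> : H = \poly_(m < n.+1) (f`_(n - m) * x ^+ (n - m)).
    rewrite /H prod_homogenize -def_f poly_def (reindex_inj rev_ord_inj) /=.
    apply: eq_bigr => m _; rewrite subSS subKn -1?ltnS // -rmorphXn /=.
    by rewrite [_ * _%:P]mulrC mul_polyC scalerA.
  by rewrite coef_poly ltnS.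
have FH : F * H = \prod_(z <- s) ((x ^+ 2 + z ^+ 2) *: 'X + - (x * z) *: (1 + 'X^2)).
  rewrite -big_split; apply: eq_bigr => z _ /=.
  rewrite -!mul_polyC !(polyCN, polyCD, polyCM, rmorphXn) /=; ring.
have FH_ i : (F * H)`_(n + i) = \sum_(m < n.+1) p`_m * (if odd (m + i) then 0 else 'C(m, (m + i)./2)%:R).
  rewrite FH prod_homogenize coef_sum; apply: eq_bigr => m _.
  have le_mn: (m <= n)%N by rewrite -ltnS.
  rewrite coefZ coefXnM -/n ltnNge (leq_trans (leq_subr _ _)) ?leq_addr //= coef_binomial_X2.
  by have -> : (n + i - (n - m) = m + i)%N by rewrite addnC -addnBA ?leq_subr // subKn // addnC.
transitivity ((F * H)`_(n + 0) - (F * H)`_(n + 2)).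
  under eq_bigr do rewrite mulrBl; rewrite sumrB !coefM addn0 addn2; congr (_ - _).
    apply: eq_bigr => k _; have le_kn: (k <= n)%N by rewrite -ltnS.
    by rewrite F_ H_ leq_subr subKn // -exprM mul2n -addnn exprD [RHS]mulrACA.
  (* In the coefficient of t^(n+2), the terms with F-index 0 and 1 vanish because H has degree at
     most n, and the one with F-index n + 2 because F does. The remaining ones match after a shift
     by one. *)
  rewrite big_ord_recl coefMX eqxx !mul0r add0r.
  rewrite [RHS]big_ord_recl H_ subn0 ltnNge leqW //= mulr0 add0r.
  rewrite [RHS]big_ord_recl H_ subSS subn0 ltnn mulr0 add0r.
  have f0: f`_n.+2 = 0 by rewrite nth_default ?sz_f.
  rewrite [RHS]big_ord_recr /= [F`_(bump 0 (bump 0 n))]F_ f0 !mul0r addr0.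
  apply: eq_bigr => k _; have le_kn: (k <= n)%N by rewrite ltnW.
  rewrite F_ H_ !subSS leq_subr subKn // coefMX /= !/bump /= !add1n -exprM mul2n -addnn.
  by rewrite addSn addnS -addSn -addSn exprD [RHS]mulrACA [f`_k.+2 * _]mulrC.
rewrite !FH_ -sumrB [RHS]big_mkcond; apply: eq_bigr => m _.
rewrite addn0 addn2 /= negbK; case: (odd m); first by rewrite mulr0 subr0.
by rewrite -mulrBr.
Qed.

(** * Log-concavity preserves negative zeros *)

Section Branden.
Variable C : archiClosedFieldType.
Implicit Types f p : {poly C}.

(** For m = 2k both sides are the Catalan number (2k)! / (k! (k+1)!). *)
Lemma bessel_coef_fact m : bessel_coef C m * m`!%:R =
  if odd m then 0 else 'C(m, m./2)%:R - 'C(m, m./2.+1)%:R.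
Proof.
rewrite /bessel_coef; have := odd_double_half m; case: (odd m) => [_|]; first by rewrite mul0r.
rewrite add0n; move: m./2 => k <-.
have nz_k: k`!%:R != 0 :> C by rewrite pnatr_eq0 -lt0n fact_gt0.
have nz_k1: k.+1%:R != 0 :> C by rewrite pnatr_eq0.
have le_k2: (k <= k.*2)%N by rewrite -addnn leq_addl.
have -> : 'C(k.*2, k.+1)%:R = k%:R * 'C(k.*2, k)%:R / k.+1%:R :> C.
  apply: (canRL (mulfK nz_k1)); rewrite -!natrM mulnC mul_bin_left.
  by rewrite -addnn addnK.
rewrite -(bin_fact le_k2) -addnn addnK factS !natrM -[in RHS]addn1 natrD.
rewrite -addn1 natrD in nz_k1 *.
by field; rewrite nz_k nz_k1.
Qed.

(** There are finitely many zeros, so they stay at a positive distance from the imaginary axis. *)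
Lemma halfplane_rooted_gap p : p != 0 -> (forall z, root p z -> 'Re z < 0) ->
  exists2 e, 0 < e & halfplane_rooted 1 e p.
Proof.
move=> nz_p; have [s def_p] := closed_field_poly_normal p.
have rt_p z : root p z = (z \in s) by rewrite def_p rootZ ?lead_coef_eq0 // root_prod_XsubC.
suffices: (forall z, z \in s -> 'Re z < 0) ->
    exists2 e, 0 < e & forall z, z \in s -> 'Re z <= - e.
  move=> gap_s p_rt; have [z|e e_gt0 s_e] := gap_s; first by rewrite -rt_p => /p_rt.
  by exists e => //; split=> // z; rewrite rt_p mul1r => /s_e.
elim: s {def_p rt_p} => [|r s IHs] s_lt0; first by exists 1; rewrite ?ltr01.
have [z s_z|e e_gt0 s_e] := IHs; first by rewrite s_lt0 // inE s_z orbT.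
have r_gt0: 0 < - 'Re r by rewrite oppr_gt0 s_lt0 ?mem_head.
case: (real_leP (gtr0_real e_gt0) (gtr0_real r_gt0)) => [le_er | lt_re].
  by exists e => // z; rewrite inE => /predU1P[->|/s_e//]; rewrite lerNr.
exists (- 'Re r) => // z; rewrite inE opprK => /predU1P[->//|/s_e/le_trans->//].
by rewrite lerNl ltW.
Qed.

(* (f * 'X)`_i is the entry to the left of f`_i, and 0 when i = 0. *)
Definition logconc_poly f : {poly C} :=
  \poly_(i < size f) (f`_i ^+ 2 - (f * 'X)`_i * f`_i.+1).

Lemma coef_logconc_poly f i :
  (logconc_poly f)`_i = f`_i ^+ 2 - (f * 'X)`_i * f`_i.+1.
Proof.
rewrite coef_poly; case: ltnP => // le_fi.
by rewrite !(nth_default 0 (leqW le_fi), nth_default 0 le_fi) mulr0 subr0 expr0n.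
Qed.

(** By [logconc_prod_XsubC] and [bessel_coef_fact], the value is the square of the leading
    coefficient times the sum in [halfplane_bessel_neq0]. *)
Lemma logconc_poly_sqr_neq0 f x : negrooted f -> 0 < 'Re x ->
  (logconc_poly f).[x ^+ 2] != 0.
Proof.
move=> nf x_gt0; have nz_f := negrooted_neq0 nf.
have nz_x: x != 0 by apply: contraTneq x_gt0 => ->; rewrite raddf0 ltxx.
have [s def_f] := closed_field_poly_normal f.
have s_lt0 z : z \in s -> z < 0.
  by move=> s_z; apply: nf.2; rewrite def_f rootZ ?lead_coef_eq0 // root_prod_XsubC.
have sz_f: size f = (size s).+1.
  by rewrite def_f size_scale ?lead_coef_eq0 // size_prod_XsubC.
rewrite horner_poly sz_f; pose g := \prod_(z <- s) ('X - z%:P).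
have f_ i : f`_i = lead_coef f * g`_i by rewrite {1}def_f coefZ.
transitivity (lead_coef f ^+ 2 * \sum_(k < (size s).+1)
  (g`_k ^+ 2 - (g * 'X)`_k * g`_k.+1) * (x ^+ 2) ^+ k != 0).
  congr (_ != 0); rewrite mulr_sumr; apply: eq_bigr => k _; rewrite !coefMX !f_.
  by case: eqP => _; ring.
rewrite mulf_eq0 expf_eq0 lead_coef_eq0 (negPf nz_f) logconc_prod_XsubC /=.
set p := \prod_(z <- s) _.
have lead_z z : z \in s -> - (x * z) != 0.
  by move=> /s_lt0 z_lt0; rewrite oppr_eq0 mulf_neq0 // lt_eqF.
have sz_p: size p = (size s).+1.
  have -> : p = \prod_(z <- s) - (x * z) *:
      \prod_(z <- s) ('X - ((x ^+ 2 + z ^+ 2) / (x * z))%:P).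
    rewrite -scaler_prod; apply: eq_big_seq => z /lead_z nz_xz.
    rewrite scalerBr -[_ *: _%:P]mul_polyC -polyCM addrC -polyCN mulNr opprK.
    by rewrite mulrCA mulfV ?mulr1 // -oppr_eq0.
  rewrite size_scale ?size_prod_XsubC // big_seq_cond prodf_seq_neq0.
  by apply/allP => z s_z; rewrite s_z lead_z.
(* Here w = x / z + z / x with z < 0, and both x and 1 / x have positive real part. *)
have p_rt w : root p w -> 'Re w < 0.
  rewrite rootE horner_prod prodf_seq_eq0 => /hasP[z s_z /=].
  have z_lt0 := s_lt0 z s_z; have nz_z: z != 0 by rewrite lt_eqF.
  rewrite !hornerE mulNr subr_eq0 => /eqP def_w.
  have -> : w = z^-1 * x + z * x^-1.
    by apply: (mulfI (mulf_neq0 nz_x nz_z)); rewrite -def_w; field; rewrite nz_x.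
  have Rz: z \is Num.real by rewrite ltr0_real.
  rewrite raddfD /= !ReMl ?rpredV // ReV ltr_nDl ?nmulr_rlt0 ?invr_lt0 //.
  by rewrite divr_gt0 ?exprn_gt0 ?normr_gt0.
have [|e e_gt0 hp] := halfplane_rooted_gap _ p_rt; first by rewrite -size_poly_gt0 sz_p.
have := halfplane_bessel_neq0 e_gt0 hp; rewrite sz_p; congr (_ != 0).
rewrite [RHS]big_mkcond; apply: eq_bigr => m _.
rewrite -[p`_m *+ _]mulr_natl mulrA bessel_coef_fact if_neg.
by case: (odd m); rewrite ?mul0r // mulrC.
Qed.

(** Write a zero as w = x^2. Neither x nor -x has positive real part, and x is nonzero since the
    constant term is f(0)^2; so x is purely imaginary and w < 0. *)
Lemma negrooted_logconc f : negrooted f -> negrooted (logconc_poly f).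
Proof.
move=> nf; have nz_f := negrooted_neq0 nf.
have [n sz_f] : exists n, size f = n.+1.
  by exists (size f).-1; rewrite prednK // size_poly_gt0.
have fn_gt0: 0 < f`_n by have [] := nf; rewrite lead_coefE sz_f.
split=> [|w].
  have lead_q: f`_n ^+ 2 - (f * 'X)`_n * f`_n.+1 = f`_n ^+ 2.
    by rewrite [f`_n.+1]nth_default ?sz_f // mulr0 subr0.
  rewrite lead_coef_poly sz_f //= lead_q ?exprn_gt0 //.
  by rewrite gt_eqF ?exprn_gt0.
rewrite -[w]sqrtCK; move: (sqrtC w) => x x_rt.
have nz_x: x != 0.
  apply: contraTneq x_rt => ->; rewrite expr0n rootE horner_coef0 coef_poly size_poly_gt0 nz_f.
  by rewrite coefMX eqxx mul0r subr0 expf_neq0 // gt_eqF ?negrooted_coef0_gt0.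
have x0: 'Re x = 0.
  apply/eqP; apply: contraTT x_rt => nz_Re; rewrite rootE.
  have [x_gt0|x_lt0|x0] := real_ltgtP (real0 _) (Creal_Re x).
  - exact: logconc_poly_sqr_neq0.
  - by rewrite -sqrrN logconc_poly_sqr_neq0 // raddfN oppr_gt0.
  by rewrite -x0 eqxx in nz_Re.
have y_nz: 'Im x != 0 by apply: contraNneq nz_x => y0; rewrite [x]Crect x0 y0 mulr0 addr0.
rewrite [x]Crect x0 add0r exprMn sqrCi mulN1r oppr_lt0 lt0r expf_neq0 //.
by rewrite -realEsqr Creal_Im.
Qed.
End Branden.

(** * Pascal determinants *)

Lemma ffact_natr_prod (R : pzRingType) n m :
  (n ^_ m)%:R = \prod_(u < m) (n%:R - u%:R) :> R.
Proof.
elim: m => [|m IHm]; first by rewrite ffactn0 big_ord0.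
rewrite big_ord_recr /= -IHm ffactnSr natrM.
have [le_mn|lt_nm] := leqP m n; first by rewrite natrB.
by rewrite ffact_small // !mul0r.
Qed.

(** The falling factorials are monic of degree s in d + r, so a unitriangular matrix relates this to
    a Vandermonde determinant. Only differences of nodes matter, hence d disappears. *)
Lemma det_ffact (R : comNzRingType) k d :
  \det (\matrix_(s < k, r < k) ((d + r) ^_ s)%:R) =
  \prod_(a < k) \prod_(b < k | (a < b)%N) (b%:R - a%:R) :> R.
Proof.
pose ff s : {poly R} := \prod_(u < s) ('X - u%:R%:P).
have sz_ff s : size (ff s) = s.+1 by rewrite size_prod_XsubC [index_enum _]unlock -enumT size_enum_ord.
pose U : 'M[R]_k := \matrix_(s, t) (ff s)`_t.
pose V := Vandermonde k (\row_(r < k) (d + r)%:R : 'rV[R]_k).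
transitivity (\det (U *m V)).
  congr (\det _); apply/matrixP => s r; rewrite !mxE ffact_natr_prod.
  transitivity (ff s).[(d + r)%:R].
    by rewrite horner_prod; apply: eq_bigr => u _; rewrite !hornerE.
  rewrite (@horner_coef_wide _ k) ?sz_ff //.
  by apply: eq_bigr => t _; rewrite !mxE.
have -> : \det (U *m V) = \det V.
  rewrite det_mulmx det_trig ?big1 ?mul1r // => [s _|].
    rewrite mxE; have /monicP := monic_prod_XsubC (index_enum 'I_s) xpredT (fun u => u%:R : R).
    by rewrite lead_coefE -/(ff s) sz_ff.
  by apply/is_trig_mxP => s t lt_st; rewrite mxE nth_default ?sz_ff.
rewrite det_Vandermonde; apply: eq_bigr => a _; apply: eq_bigr => b _.
by rewrite !mxE !natrD opprD addrACA subrr add0r.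
Qed.

(** Apart from the binomial and [(d + r) ^_ s], each factor depends on only one of r and s, so it
    can be pulled out of a row or column. *)
Lemma bin_ffact_shift j d r s :
  ('C(j + d + r, j + s) * ((j + s)`! * (d + r)`!) = (j + d + r)`! * (d + r) ^_ s)%N.
Proof.
have [le_s | lt_s] := leqP s (d + r)%N; last first.
  by rewrite ffact_small // muln0 bin_small // -addnA ltn_add2l.
rewrite -(ffact_fact le_s) [((d + r) ^_ s * _)%N]mulnC mulnA mulnA -mulnA.
have le_js: (j + s <= j + d + r)%N by rewrite -addnA leq_add2l.
by rewrite -[in RHS](bin_fact le_js) -addnA subnDl !mulnA.
Qed.

Lemma PD_product (F : numFieldType) k i j : (j <= i)%N ->
  (PD k i j)%:~R =
  (\prod_(a < k) \prod_(b < k | (a < b)%N) (b%:R - a%:R)) *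
  \prod_(r < k) (i + r)`!%:R *
  \prod_(r < k) ((j + r)`! * (i - j + r)`!)%:R^-1 :> F.
Proof.
move=> /subnKC; move: (i - j)%N => d <-{i}.
have nz_fact m : m`!%:R != 0 :> F by rewrite pnatr_eq0 -lt0n fact_gt0.
rewrite -(det_ffact F k d) /PD -det_map_mx -det_tr.
set N := (\matrix_(s < k, r < k) _ : 'M[F]_k).
pose x := \row_(s < k) (j + s)`!%:R^-1 : 'rV[F]_k.
pose y := \row_(r < k) ((j + d + r)`!%:R / (d + r)`!%:R) : 'rV[F]_k.
transitivity (\det (diag_mx x *m N *m diag_mx y)).
  congr (\det _); apply/matrixP => s r; rewrite mul_mx_diag mul_diag_mx !mxE /pascal.
  have := congr1 (fun m => m%:R : F) (bin_ffact_shift j d r s).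
  rewrite /= -pmulrn !natrM => /(canRL (mulfK (mulf_neq0 (nz_fact _) (nz_fact _))))->.
  by field; rewrite !nz_fact.
rewrite !det_mulmx !det_diag [_ * \det N]mulrC -!mulrA; congr (_ * _).
rewrite -!big_split; apply: eq_bigr => r _ /=; rewrite !mxE natrM.
by field; rewrite !nz_fact.
Qed.

Lemma PD_eq0 k i j : (0 < k)%N -> (i < j)%N -> PD k i j = 0.
Proof.
case: k => // k _ lt_ij; rewrite /PD (expand_det_row _ ord0) big1 // => s _.
by rewrite mxE /pascal addn0 bin_small ?mul0r // ltn_addr.
Qed.

Lemma negrootedZ (C : numClosedFieldType) c (p : {poly C}) :
  0 < c -> negrooted p -> negrooted (c *: p).
Proof.
move=> c_gt0 [lead_gt0 p_rt]; split=> [|z]; first by rewrite lead_coefZ mulr_gt0.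
by rewrite rootZ ?gt_eqF //; apply: p_rt.
Qed.

(** For k = 1 these are the binomials over n!; each further factor r is a use of
    [negrooted_div_fact] with shift r. *)
Lemma negrooted_prod_div_fact (C : numClosedFieldType) k n : (0 < k)%N ->
  negrooted (\poly_(j < n.+1) \prod_(r < k) ((j + r)`! * (n - j + r)`!)%:R^-1 : {poly C}).
Proof.
have fact_gt0C m : 0 < m`!%:R^-1 :> C by rewrite invr_gt0 ltr0n fact_gt0.
case: k => // k _; elim: k => [|k IHk].
  have := negrootedZ (fact_gt0C n) (negrooted_binomial C n); congr negrooted.
  apply/polyP=> j; rewrite coefZ !coef_poly ltnS; case: leqP => le_jn; last by rewrite mulr0.
  rewrite big_ord1 !addn0 -(bin_fact le_jn) natrM invfM mulrAC mulVf ?mul1r //.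
  by rewrite pnatr_eq0 -lt0n bin_gt0.
set f := \poly_(_ < _) _ in IHk.
have sz_f: size f = n.+1.
  rewrite size_poly_eq //; apply/prodf_neq0 => r _.
  by rewrite invr_eq0 pnatr_eq0 -lt0n muln_gt0 !fact_gt0.
have := negrooted_div_fact k.+1 IHk sz_f; congr negrooted.
apply/polyP=> j; rewrite /f !coef_poly; case: ltnP => // _.
by rewrite [RHS]big_ord_recr.
Qed.

(** Cutting off after index [i] loses nothing for the iterates of L on [PD k], whose row [i]
    vanishes beyond [i]. *)
Definition row_poly (A : array) i : {poly algC} := \poly_(j < i.+1) (A i j)%:~R.

Lemma negrooted_row_PD k i : (0 < k)%N -> negrooted (row_poly (PD k) i).
Proof.
move=> k_gt0; pose c : algC :=
  (\prod_(a < k) \prod_(b < k | (a < b)%N) (b%:R - a%:R)) * \prod_(r < k) (i + r)`!%:R.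
have c_gt0: 0 < c.
  rewrite mulr_gt0 ?prodr_gt0 // => [a _|r _]; last by rewrite ltr0n fact_gt0.
  by rewrite prodr_gt0 // => b lt_ab; rewrite subr_gt0 ltr_nat.
have := negrootedZ c_gt0 (negrooted_prod_div_fact algC i k_gt0); congr negrooted.
apply/polyP=> j; rewrite coefZ !coef_poly ltnS.
by case: leqP => le_ji; rewrite ?mulr0 // PD_product.
Qed.

Lemma row_poly_logconc A i : (forall j, (i < j)%N -> A i j = 0) ->
  row_poly (logconc A) i = logconc_poly (row_poly A i).
Proof.
move=> A0; have A_ j : (row_poly A i)`_j = (A i j)%:~R.
  by rewrite coef_poly ltnS; case: leqP => // /A0->.
apply/polyP=> j; rewrite coef_logconc_poly coefMX !A_.
have [le_ji|lt_ij] := leqP j i.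
  rewrite coef_poly ltnS le_ji /logconc rmorphB rmorphXn rmorphM /=.
  by case: j {le_ji} => [|j] //=; rewrite A_.
rewrite coef_poly ltnS leqNgt lt_ij (A0 j) // (A0 j.+1) ?leqW //.
by rewrite mulr0 subr0 expr0n.
Qed.

Theorem theorem5p1 (k : nat) (hk : (1 <= k)%N) (i : nat) :
  row_infinitely_log_concave (PD k) i.
Proof.
move=> m _ j; pose A m := iter m logconc (PD k); rewrite -/(A m).
(* The invariant carried through the iteration: the support of the row stays within 0..i, and its
   generating polynomial has only negative zeros, hence nonnegative coefficients. *)
suffices [A0 nA]: (forall j, (i < j)%N -> A m i j = 0) /\ negrooted (row_poly (A m) i).
  have [le_ji|/A0->//] := leqP j i.
  by have := negrooted_coef_ge0 j nA; rewrite coef_poly ltnS le_ji ler0z.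
elim: m => [|m [A0 nA]].
  by split=> [l|]; [apply: PD_eq0 | apply: negrooted_row_PD].
have A0S l : (i < l)%N -> A m.+1 i l = 0.
  by move=> lt_il; rewrite /A /= -/(A m) /logconc (A0 l lt_il) (A0 l.+1 (leqW lt_il)) mulr0 subr0 expr0n.
by split=> //; rewrite /A /= -/(A m) row_poly_logconc //; apply: negrooted_logconc.
Qed.
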